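(* Let $\mathbb K$ be an infinite field, $d\ge1$, $\mathbf m\in\mathbb N^d$, and let $U\subseteq P(d,\mathbf m)$ be a color-squarefree shifted monomial order ideal. Then, as ideals of $P(d,\mathbf m+(1,\dots,1))$, $$I(U)\,P(d,\mathbf m+(1,\dots,1))=\mathrm{gin}_\prec(I_{\Delta_{\mathrm{bal}}(U)}),$$ where $\mathrm{gin}_\prec$ denotes the multigraded generic initial ideal.
   Context: Here $\mathbb N$ contains $0$. $P(d,\mathbf m)$ is the polynomial ring over $\mathbb K$ in variables $x_{i,j}$, $1\le i\le d$, $1\le j\le m_i$; $x_{i,j}$ has color $i$ and $\mathbb Z^d$-degree the unit vector $\mathbf e_i$. A monomial is color-squarefree if it is squarefree and divisible by at most one variable of each color. A color-squarefree monomial order ideal is a set $U$ of color-squarefree monomials of $P(d,\mathbf m)$ closed under taking divisors; throughout, it is assumed to contain $1$ and all variables of $P(d,\mathbf m)$. It is color-squarefree shifted if $x_{k,\ell}u\in U$ implies $x_{k,j}u\in U$ for all $\ell\le j\le m_k$. $I(U)$ is the ideal of $P(d,\mathbf m)$ generated by all monomials of $P(d,\mathbf m)$ not in $U$. Balanced squeezed complex: let $V_i=\{1^{(i)},\dots,(m_i+1)^{(i)}\}$. For $u=x_{i_1,j_1}\cdots x_{i_s,j_s}$ color-squarefree with $i_1<\dots<i_s$ put $F_d(u)=\{j_1^{(i_1)},\dots,j_s^{(i_s)}\}\cup\{(m_j+1)^{(j)} : j\in[d]\setminus\{i_1,\dots,i_s\}\}$. Then $\Delta_{\mathrm{bal}}(U)$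 is the simplicial complex whose facets are the sets $F_d(u)$, $u\in U$. Its Stanley-Reisner ideal $I_{\Delta_{\mathrm{bal}}(U)}\subseteq P(d,\mathbf m+(1,\dots,1))$ uses the variable $x_{i,j}$ for the vertex $j^{(i)}$. Multigraded generic initial ideal: write $P(d,\mathbf n)$ with $\mathbf n=\mathbf m+(1,\dots,1)$. The group $GL_{n_1}(\mathbb K)\times\cdots\times GL_{n_d}(\mathbb K)$ acts on $P(d,\mathbf n)$ by $\mathbb Z^d$-graded algebra automorphisms, $\varphi=((a^{(j)}_{k,\ell}))_j$ acting by $\varphi(x_{j,i})=\sum_k a^{(j)}_{k,i}x_{j,k}$. Let $\prec$ be a total order on the variables with $x_{j,n_j}\prec\cdots\prec x_{j,1}$ for every $j$, and let $\mathrm{in}_\prec$ denote the initial ideal with respect to the induced (degree) reverse lexicographic order. For a $\mathbb Z^d$-graded ideal $I$ there are nonempty Zariski open sets $U_i\subseteq GL_{n_i}(\mathbb K)$ such that $\mathrm{in}_\prec(\varphi(I))$ is the same ideal for all $\varphi\in U_1\times\cdots\times U_d$; this ideal is $\mathrm{gin}_\prec(I)$. *)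

(* Defs.v *)
From HB Require Import structures.
From mathcomp Require Import all_boot all_order all_algebra.
From mathcomp Require Import mpoly.
From mathcomp Require Import boolp classical_sets cardinality.

Set Implicit Arguments.
Unset Strict Implicit.
Unset Printing Implicit Defensive.

Import GRing.Theory.
Local Open Scope ring_scope.
Local Open Scope classical_set_scope.

(** * Ideals of a commutative ring, as subsets *)

Definition is_ideal (R : comNzRingType) (I : set R) : Prop :=
  [/\ I 0, (forall f g, I f -> I g -> I (f + g))
    & (forall a f, I f -> I (a * f))].

Definition ideal_gen (R : comNzRingType) (S : set R) : set R :=
  smallest (@is_ideal R) S.

(** * The ring P(d, n)

  Colors and positions are numbered from 0: the variable x_{i,j} with
  1 <= i <= d and 1 <= j <= n_i is [Tagged _ j' : var n] with tag i' : 'I_d and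
  j' : 'I_(n i'), where i' = i - 1 and j' = j - 1. The library's polynomials
  have variables indexed by an ordinal, whence the passage through
  [enum_rank] and [enum_val]; the enumeration plays no role beyond naming
  (monomial orders below never refer to it). *)

Definition var (d : nat) (n : 'I_d -> nat) : finType := {i : 'I_d & 'I_(n i)}.

Definition mkvar (d : nat) (n : 'I_d -> nat) (i : 'I_d) (j : 'I_(n i)) : var n :=
  Tagged (fun i => 'I_(n i)) j.

Definition mon (d : nat) (n : 'I_d -> nat) := 'X_{1..#|var n|}.

Definition P (K : fieldType) (d : nat) (n : 'I_d -> nat) := {mpoly K[#|var n|]}.

Definition expo (d : nat) (n : 'I_d -> nat) (u : mon n) (v : var n) : nat :=
  u (enum_rank v).

Definition mvar (d : nat) (n : 'I_d -> nat) (v : var n) : mon n :=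
  U_(enum_rank v)%MM.

Definition pvar (K : fieldType) (d : nat) (n : 'I_d -> nat) (v : var n)
  : P K n := 'X_(enum_rank v).

(* The K-algebra homomorphism sending each variable v to h v. *)
Definition psubst (K : fieldType) (d e : nat) (n : 'I_d -> nat)
    (n' : 'I_e -> nat) (h : var n -> P K n') (p : P K n) : P K n' :=
  p \mPo [tuple h (enum_val r) | r < #|var n|].

(** * Color-squarefree shifted monomial order ideals *)

Definition color_squarefree (d : nat) (n : 'I_d -> nat) (u : mon n) : Prop :=
  (forall v : var n, (expo u v <= 1)%N) /\
  (forall (i : 'I_d) (j k : 'I_(n i)),
     (0 < expo u (mkvar j))%N -> (0 < expo u (mkvar k))%N -> j = k).

Definition csf_order_ideal (d : nat) (n : 'I_d -> nat) (U : set (mon n)) : Prop :=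
  [/\ (forall u, U u -> color_squarefree u),
      (forall u w, U u -> (w <= u)%MM -> U w),
      U 0%MM
    & (forall v : var n, U (mvar v))].

Definition csf_shifted (d : nat) (n : 'I_d -> nat) (U : set (mon n)) : Prop :=
  forall (k : 'I_d) (l j : 'I_(n k)) (u : mon n),
    (l <= j)%N -> U (mvar (mkvar l) + u)%MM -> U (mvar (mkvar j) + u)%MM.

Definition ideal_of (K : fieldType) (d : nat) (n : 'I_d -> nat)
    (U : set (mon n)) : set (P K n) :=
  ideal_gen [set 'X_[u] | u in ~` U].

Arguments ideal_of K {d n} U.

(** * Extension of ideals along P(d, m) -> P(d, m + (1,...,1)) *)

Definition succv (d : nat) (m : 'I_d -> nat) : 'I_d -> nat := fun i => (m i).+1.

Definition incl_var (d : nat) (m : 'I_d -> nat) (v : var m) : var (succv m) :=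
  @mkvar d (succv m) (tag v) (widen_ord (leqnSn (m (tag v))) (tagged v)).

Definition incl (K : fieldType) (d : nat) (m : 'I_d -> nat) (p : P K m)
  : P K (succv m) := psubst (fun v => pvar K (incl_var v)) p.

Definition extend (K : fieldType) (d : nat) (m : 'I_d -> nat)
    (I : set (P K m)) : set (P K (succv m)) :=
  ideal_gen (incl (m := m) @` I).

(** * Simplicial complexes and Stanley-Reisner ideals

  The vertex j^(i) is identified with the index of the variable x_{i,j}. *)

Definition complex_gen (T : finType) (F : set {set T}) : set {set T} :=
  [set G | exists2 H, F H & G \subset H].

Definition stanley_reisner (K : fieldType) (d : nat) (n : 'I_d -> nat)
    (D : set {set var n}) : set (P K n) :=
  ideal_gen [set \prod_(v in G) pvar K v | G in ~` D].

Arguments stanley_reisner K {d n} D.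

(* F_d(u); the vertex (m_i + 1)^(i) is [ord_max] in color i. *)
Definition bal_facet (d : nat) (m : 'I_d -> nat) (u : mon m)
  : {set var (succv m)} :=
  ([set incl_var v | v : var m & (0 < expo u v)%N]
   :|: [set @mkvar d (succv m) i ord_max
         | i : 'I_d & [forall j : 'I_(m i), expo u (mkvar j) == 0%N]])%SET.

(* All the sets F_d(u), u in U, have d elements, so they are the facets of the
   complex they generate. *)
Definition bal_complex (d : nat) (m : 'I_d -> nat) (U : set (mon m))
  : set {set var (succv m)} :=
  complex_gen [set bal_facet u | u in U].

(** * Degree reverse lexicographic order and initial ideals *)

(* Strict total orders on the variables with
   x_{i,n_i} < ... < x_{i,1} for every color i. *)
Definition var_order (d : nat) (n : 'I_d -> nat) (prec : rel (var n)) : Prop :=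
  [/\ irreflexive prec, transitive prec,
      (forall x y, x != y -> prec x y || prec y x)
    & (forall (i : 'I_d) (j k : 'I_(n i)),
         (j < k)%N -> prec (mkvar k) (mkvar j))].

(* u < w: smaller degree, or same degree and u has the larger exponent at the
   prec-smallest variable where the exponents differ. *)
Definition revlex_lt (d : nat) (n : 'I_d -> nat) (prec : rel (var n))
    (u w : mon n) : bool :=
  (mdeg u < mdeg w)%N ||
  ((mdeg u == mdeg w) &&
   [exists x : var n, (expo w x < expo u x)%N &&
      [forall y : var n, prec y x ==> (expo u y == expo w y)]]).

Definition is_initial_mon (K : fieldType) (d : nat) (n : 'I_d -> nat)
    (prec : rel (var n)) (f : P K n) (u : mon n) : Prop :=
  u \in msupp f /\
  (forall w, w \in msupp f -> w != u -> revlex_lt prec w u).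

Definition initial_ideal (K : fieldType) (d : nat) (n : 'I_d -> nat)
    (prec : rel (var n)) (I : set (P K n)) : set (P K n) :=
  ideal_gen [set 'X_[u] | u in
               [set u | exists2 f, I f & is_initial_mon prec f u]].

(** * Multigraded generic initial ideals *)

(* Zariski open subsets of GL_n(K), as sets of invertible matrices. Negative
   powers of the determinant are not needed among the defining functions. *)
Definition zariski_open_GL (K : fieldType) (n : nat) (W : set 'M[K]_n) : Prop :=
  exists S : set {mpoly K[n * n]},
    W = [set A | A \in unitmx /\
                 exists2 f, S f & f.@[fun k => mxvec A 0 k] != 0].

(* phi(x_{i,j}) = \sum_k a^(i)_{k,j} x_{i,k}. *)
Definition GL_act (K : fieldType) (d : nat) (n : 'I_d -> nat)
    (phi : forall i : 'I_d, 'M[K]_(n i)) : P K n -> P K n :=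
  psubst (fun v : var n =>
    \sum_(k < n (tag v)) phi (tag v) k (tagged v) *: pvar K (mkvar k)).

Definition is_gin (K : fieldType) (d : nat) (n : 'I_d -> nat)
    (prec : rel (var n)) (I J : set (P K n)) : Prop :=
  exists2 W : forall i : 'I_d, set 'M[K]_(n i),
    (forall i, zariski_open_GL (W i) /\ W i !=set0) &
    (forall phi : forall i : 'I_d, 'M[K]_(n i),
       (forall i, W i (phi i)) ->
       initial_ideal prec (GL_act phi @` I) = J).

(* The default value set0 is not an ideal, so an ideal J can only be equal to
   [gin prec I] if [is_gin prec I J] holds. Over an infinite field, there is at
   most one such J, because nonempty open subsets of GL_n(K) meet. *)
Definition gin (K : fieldType) (d : nat) (n : 'I_d -> nat)
    (prec : rel (var n)) (I : set (P K n)) : set (P K n) :=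
  xget set0 [set J | is_gin prec I J].

(* Main.v *)
Require Import Defs.
From HB Require Import structures.
From mathcomp Require Import all_boot all_order all_algebra.
From mathcomp Require Import mpoly.
From mathcomp Require Import boolp classical_sets cardinality.

(** Let phi = (A_i) be an element of the product of the groups GL_(n_i)(K),
  n_i = m_i + 1, let Delta be the balanced squeezed complex of U, and let
  y_(i,l) = phi(x_(i,l)). The rows of A_i^-1 are points p_(i,1), ...,
  p_(i,n_i) of K^(n_i), and the linear form y_(i,l) is 1 at p_(i,l) and 0 at
  the others. Call a monomial of P(d, n) standard if the part of it in the
  variables x_(i,j), j <= m_i, lies in U; the other monomials are exactly those
  of I(U) P(d, n). For A_i whose leading principal minors are all nonzero and
  for which A_i^-1 has no zero in its last column, the initial monomials of
  phi(I_Delta) are shown to be the nonstandard ones. Both conditions are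
  Zariski open and, as a unitriangular example shows, not empty.

  Every nonstandard monomial is initial ([exists_initial_nonstandard]). If u
  is color-squarefree and not in U, LU decomposition gives for every variable
  x_(i,j) of u a combination of y_(i,1), ..., y_(i,j) whose initial monomial is
  x_(i,j). Expanding the product of these forms gives products of variables
  y_(i,l), l <= j, none of which is supported on a face, since U is shifted. If u is
  not color-squarefree, it is divisible by some x_(i,j) x_(i,k) with
  j, k <= m_i. As y_(i,a) y_(i,b) lies in phi(I_Delta) for a <> b, a quadric in
  the variables of color i lies in phi(I_Delta) as soon as it vanishes at all
  p_(i,a); the last coordinates of these points being nonzero,
  x_(i,j) x_(i,k) can be completed to such a quadric by multiples of the
  smallest variable x_(i,n_i), and these are smaller in the reverse
  lexicographic order.

  No standard monomial is initial ([initial_mon_nonstandard]). A facet F_d(u)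
  chooses a point p_(i,c_i) for every color, and phi(I_Delta) vanishes on the
  span of the chosen points, that is, under
  x_(i,j) |-> (coordinate j of p_(i,c_i)) t_i. In multidegree a this gives one
  linear functional for every standard monomial of degree a, and the
  functionals are independent, because the products of the y_(i,c_i)^(a_i) form
  a dual family. Vectors with different initial monomials are independent too,
  so the nonstandard monomials of degree a already use up the dimension of the
  common kernel ([card_initial_le]).

  Finally, two nonempty open subsets of GL_n over an infinite field meet, as
  one sees on a line through a point of each ([zariski_openI_neq0]); hence the
  generic initial ideal is unique. *)

Set Implicit Arguments.
Unset Strict Implicit.
Unset Printing Implicit Defensive.

Import GRing.Theory.
Local Open Scope ring_scope.

(** * Counting initial terms *)

(** Echelon form: in a vanishing linear combination of the rows, look at the
  largest initial position of a row with a nonzero coefficient; only that row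
  contributes there. *)
Lemma row_free_initial (F : fieldType) (T : finType) (lt : rel T) r
    (t : 'I_r -> T) (R : 'M[F]_(r, #|T|)) :
  irreflexive lt -> transitive lt -> injective t ->
  (forall i, R i (enum_rank (t i)) != 0) ->
  (forall i s, R i (enum_rank s) != 0 -> s = t i \/ lt s (t i)) ->
  row_free R.
Proof.
move=> ltxx lt_tr t_inj Rii Rlt; apply: inj_row_free => v vR0.
apply/rowP=> i0; rewrite mxE; apply: contraTeq isT => vi0.
(* The number of smaller positions is strictly monotone, which turns the choice
   of a maximal position into a maximum of natural numbers. *)
pose below s := #|[pred s' | lt s' s]|.
have below_lt s s' : lt s s' -> (below s < below s')%N.
  move=> ss'; apply/proper_card/fintype.properP; split.
    by apply/fintype.subsetP=> x; rewrite !inE => /lt_tr; apply.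
  by exists s; rewrite !inE ?ss' ?ltxx.
pose i := [arg max_(i > i0 | v ord0 i != 0%R) below (t i)]%N.
have [vi imax] : v ord0 i != 0 /\
    forall k, v ord0 k != 0 -> (below (t k) <= below (t i))%N.
  by rewrite /i; case: arg_maxnP.
have /rowP/(_ (enum_rank (t i))) := vR0.
rewrite !mxE (bigD1 i) //= big1 ?addr0 => [|k ki].
  by move/eqP; rewrite mulf_eq0 (negbTE vi) (negbTE (Rii i)).
apply/eqP; rewrite mulf_eq0; apply/norP=> -[vk /Rlt [/t_inj ik|/below_lt]].
  by rewrite ik eqxx in ki.
by rewrite ltnNge imax.
Qed.

(** The g x are independent, having distinct initial positions, and they lie in
  the common kernel of the functionals e s. The latter are independent, being
  dual to the y s, so their common kernel has codimension #|S|. *)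
Lemma card_initial_le (F : fieldType) (T : finType) (lt : rel T)
    (X S : {set T}) (g e y : T -> T -> F) :
  irreflexive lt -> transitive lt ->
  (forall x, x \in X -> g x x != 0) ->
  (forall x t, x \in X -> g x t != 0 -> t = x \/ lt t x) ->
  (forall x s, x \in X -> s \in S -> \sum_t g x t * e s t = 0) ->
  (forall s s', s \in S -> s' \in S -> \sum_t y s t * e s' t = (s == s')%:R) ->
  (#|X| + #|S| <= #|T|)%N.
Proof.
move=> ltxx lt_tr gxx glt ge0 ye1.
pose R : 'M[F]_(#|X|, #|T|) := \matrix_(i, k) g (enum_val i) (enum_val k).
pose E : 'M[F]_(#|T|, #|S|) := \matrix_(k, j) e (enum_val j) (enum_val k).
pose Y : 'M[F]_(#|S|, #|T|) := \matrix_(j, k) y (enum_val j) (enum_val k).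
have sumT (h : T -> F) : \sum_(k < #|T|) h (enum_val k) = \sum_t h t.
  by rewrite -(big_enum_val (fun t => h t)).
have RE : R *m E = 0.
  apply/matrixP=> i j; rewrite !mxE; under eq_bigr do rewrite !mxE.
  rewrite (sumT (fun t => g (enum_val i) t * e (enum_val j) t)).
  by rewrite ge0 ?enum_valP.
have YE : Y *m E = 1%:M.
  apply/matrixP=> i j; rewrite !mxE; under eq_bigr do rewrite !mxE.
  rewrite (sumT (fun t => y (enum_val i) t * e (enum_val j) t)).
  by rewrite ye1 ?enum_valP // (inj_eq enum_val_inj).
have Rfree : row_free R.
  apply: (@row_free_initial _ _ lt _ (fun i => enum_val i)) => //.
  - exact: enum_val_inj.
  - by move=> i; rewrite mxE enum_rankK gxx ?enum_valP.
  - by move=> i s; rewrite mxE enum_rankK => /glt; apply; apply: enum_valP.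
have := mulmx0_rank_max RE; move: Rfree; rewrite /row_free => /eqP ->.
suff -> : \rank E = #|S| by [].
apply/eqP; rewrite eqn_leq rank_leq_col /=.
by have := mxrankM_maxr Y E; rewrite YE mxrank1.
Qed.

(** * Zariski open sets of invertible matrices *)

Lemma infinite_nonroot (K : fieldType) (p : {poly K}) :
  infinite_set [set: K]%classic -> p != 0 -> exists a, p.[a] != 0.
Proof.
move=> Kinf p0; apply: contrapT => allroot.
have [B _ Bsize] := infinite_set_fset (size p) Kinf.
have : (size (finmap.enum_fset B) < size p)%N.
  apply: max_poly_roots => //; last exact: finmap.fset_uniq.
  apply/allP=> a _; apply/rootP/eqP; apply: contrapT => /negP pa.
  by apply: allroot; exists a.
by rewrite ltnNge Bsize.
Qed.

(** The restriction of f to the line through a and b, with a at time 0 and b at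
  time 1. *)
Definition line_poly (K : fieldType) n (f : {mpoly K[n]}) (a b : 'I_n -> K)
  : {poly K} := mmap (@polyC K) (fun k => (a k)%:P + (b k - a k) *: 'X) f.

Lemma horner_line (K : fieldType) n (f : {mpoly K[n]}) (a b : 'I_n -> K) s :
  (line_poly f a b).[s] = f.@[fun k => a k + (b k - a k) * s].
Proof.
rewrite /line_poly /mmap horner_sum /meval /mmap; apply: eq_bigr => u _.
rewrite hornerM hornerC /mmap1 horner_prod; congr (_ * _).
by apply: eq_bigr => k _; rewrite horner_exp !hornerE.
Qed.

(** On the line through a point of V and a point of W, the equations defining V,
  W and GL_n restrict to nonzero univariate polynomials, since each of them is
  nonzero at one of the two points. *)
Lemma zariski_openI_neq0 (K : fieldType) n (V W : set 'M[K]_n) :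
  infinite_set [set: K]%classic -> zariski_open_GL V -> zariski_open_GL W ->
  (V !=set0 -> W !=set0 -> exists2 A, V A & W A)%classic.
Proof.
move=> Kinf [S ->] [S' ->] [A [Au [f Sf fA]]] [B [Bu [g Sg gB]]].
pose detp : {mpoly K[n * n]} := \det (\matrix_(i, j) 'X_(mxvec_index i j)).
have detpE (C : 'M[K]_n) : detp.@[fun k => mxvec C 0 k] = \det C.
  rewrite /detp -det_map_mx; congr (\det _); apply/matrixP=> i j.
  by rewrite !mxE /= mevalXU mxvecE.
pose ln p := line_poly p (fun k => mxvec A 0 k) (fun k => mxvec B 0 k).
pose C s := A + s *: (B - A).
have lnE p s : (ln p).[s] = p.@[fun k => mxvec (C s) 0 k].
  rewrite /ln horner_line; apply: meval_eq => k.
  by rewrite /C linearD linearZ linearB /= !mxE mulrC.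
have C0 : C 0 = A by rewrite /C scale0r addr0.
have C1 : C 1 = B by rewrite /C scale1r addrC subrK.
have nz p s : (ln p).[s] != 0 -> ln p != 0.
  by apply: contraNneq => ->; rewrite horner0.
have prodnz : ln f * ln g * ln detp != 0.
  rewrite !mulf_neq0 //.
  - by apply: (nz _ 0); rewrite lnE C0.
  - by apply: (nz _ 1); rewrite lnE C1.
  - by apply: (nz _ 0); rewrite lnE C0 detpE -unitfE.
have [s] := infinite_nonroot Kinf prodnz.
rewrite !hornerM !mulf_eq0 !negb_or !lnE detpE.
move=> /andP[/andP[fs gs] ds].
have Cu : C s \in unitmx by rewrite unitmxE unitfE.
exists (C s).
  by split=> //; exists f.
by split=> //; exists g.
Qed.

(** * Monomials and the reverse lexicographic order *)

Section Monomials.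
Context (d : nat) (n : 'I_d -> nat).
Implicit Types (u w : mon n) (v : var n).

Lemma monP u w : (forall v, expo u v = expo w v) -> u = w.
Proof. by move=> uw; apply/mnmP=> r; rewrite -(enum_valK r); apply: uw. Qed.

Lemma lemonP u w : reflect (forall v, (expo u v <= expo w v)%N) (u <= w)%MM.
Proof.
apply: (iffP mnm_lepP) => uw v; first exact: uw.
by rewrite -(enum_valK v); apply: uw.
Qed.

Lemma expoD u w v : expo (u + w)%MM v = (expo u v + expo w v)%N.
Proof. exact: mnmDE. Qed.

Lemma expo_mvar v v' : expo (mvar v) v' = (v == v').
Proof. by rewrite /expo mnm1E (inj_eq enum_rank_inj). Qed.

Lemma expo_sum (I : Type) (r : seq I) (Q : pred I) (F : I -> mon n) v :
  expo (\sum_(i <- r | Q i) F i)%MM v = (\sum_(i <- r | Q i) expo (F i) v)%N.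
Proof. exact: mnm_sumE. Qed.

Lemma mdeg_expo u : mdeg u = (\sum_(v : var n) expo u v)%N.
Proof. by rewrite mdegE (reindex enum_rank) //=; apply/onW_bij/enum_rank_bij. Qed.

Lemma mkvarK v : mkvar (tagged v) = v.
Proof. by case: v. Qed.

Lemma big_var (R : Type) (idx : R) (op : Monoid.com_law idx)
    (F : var n -> R) :
  \big[op/idx]_(v : var n) F v =
  \big[op/idx]_(i < d) \big[op/idx]_(j < n i) F (mkvar j).
Proof.
pose J i : finType := 'I_(n i).
rewrite (@sig_big_dep _ _ op _ J xpredT (fun _ _ => true)
  (fun i (j : J i) => F (mkvar j))) /=.
by apply: eq_bigr => v _; rewrite mkvarK.
Qed.

(** The degree for the grading of P(d, n) by Z^d. *)
Definition mcdeg u : 'X_{1..d} :=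
  [multinom (\sum_(j < n i) expo u (mkvar j))%N | i < d].

Lemma mcdegE u i : mcdeg u i = (\sum_(j < n i) expo u (mkvar j))%N.
Proof. exact: mnmE. Qed.

Lemma mdeg_mcdeg u : mdeg (mcdeg u) = mdeg u.
Proof.
by rewrite mdeg_expo big_var mdegE; apply: eq_bigr => i _; rewrite mcdegE.
Qed.

Lemma expo_le_mcdeg u v : (expo u v <= mcdeg u (tag v))%N.
Proof. by rewrite mcdegE -{1}(mkvarK v) (bigD1 (tagged v)) //= leq_addr. Qed.

End Monomials.

Section RevLex.
Context (d : nat) (n : 'I_d -> nat) (prec : rel (var n)).
Context (prec_order : var_order prec).
Implicit Types (u w s : mon n) (v x y : var n).

Lemma revlex_lt_irr : irreflexive (revlex_lt prec).
Proof.
move=> u; rewrite /revlex_lt ltnn eqxx /=; apply/existsP=> -[x].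
by rewrite ltnn.
Qed.

Lemma revlex_ltD2r s u w :
  revlex_lt prec (u + s)%MM (w + s)%MM = revlex_lt prec u w.
Proof.
rewrite /revlex_lt !mdegD ltn_add2r eqn_add2r; congr (_ || _ && _).
apply: eq_existsb => x; rewrite !expoD ltn_add2r; congr (_ && _).
by apply: eq_forallb => y; rewrite !expoD eqn_add2r.
Qed.

Lemma revlex_lt_trans : transitive (revlex_lt prec).
Proof.
case: prec_order => irr tr tot _ w u z /orP[uw|/andP[/eqP uw]].
  move=> /orP[|/andP[/eqP wz _]]; last by rewrite /revlex_lt -wz uw.
  by rewrite /revlex_lt => /(ltn_trans uw) ->.
move=> /existsP[x /andP[xuw /forallP xeq]] /orP[|/andP[/eqP wz]].
  by rewrite /revlex_lt -uw => ->.
move=> /existsP[y /andP[ywz /forallP yeq]].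
rewrite /revlex_lt uw wz ltnn eqxx /=.
have [xy|/tot/orP[xy|yx]] := eqVneq x y.
- rewrite xy in xuw xeq; apply/existsP; exists y.
  rewrite (ltn_trans ywz xuw) /=; apply/forallP=> t; apply/implyP=> ty.
  by rewrite (eqP (implyP (xeq t) ty)) (implyP (yeq t) ty).
- apply/existsP; exists x.
  rewrite -(eqP (implyP (yeq x) xy)) xuw /=; apply/forallP=> t; apply/implyP=> tx.
  by rewrite (eqP (implyP (xeq t) tx)) (implyP (yeq t) (tr _ _ _ tx xy)).
- apply/existsP; exists y.
  rewrite (eqP (implyP (xeq y) yx)) ywz /=; apply/forallP=> t; apply/implyP=> ty.
  by rewrite (eqP (implyP (xeq t) (tr _ _ _ ty yx))) (implyP (yeq t) ty).
Qed.

Context (K : fieldType).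
Implicit Types (f g : P K n).

Lemma initialX u : is_initial_mon prec ('X_[u] : P K n) u.
Proof.
by split=> [|w]; rewrite msuppX inE // => /eqP -> /eqP.
Qed.

(** A pair of monomials of the factors other than the pair of initial ones has a
  strictly smaller product, so that the coefficient at the product of the
  initial monomials is a product of two nonzero coefficients. *)
Lemma initialM f g u w : is_initial_mon prec f u -> is_initial_mon prec g w ->
  is_initial_mon prec (f * g) (u + w)%MM.
Proof.
move=> [fu fmax] [gw gmax].
have lt_uw u' w' : u' \in msupp f -> w' \in msupp g -> (u', w') != (u, w) ->
    revlex_lt prec (u' + w')%MM (u + w)%MM.
  move=> fu' gw'; rewrite xpair_eqE negb_and.
  have [->|nu] := eqVneq u' u => /= nw.
    by rewrite ![(u + _)%MM]addmC revlex_ltD2r gmax.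
  have lt_u : revlex_lt prec (u' + w')%MM (u + w')%MM.
    by rewrite revlex_ltD2r fmax.
  have [-> |nw'] := eqVneq w' w; first by rewrite revlex_ltD2r fmax.
  apply: revlex_lt_trans lt_u _.
  by rewrite ![(u + _)%MM]addmC revlex_ltD2r gmax.
split.
  rewrite mcoeff_msupp mpolyME raddf_sum /= big_allpairs.
  rewrite (bigD1_seq u) ?msupp_uniq //=.
  rewrite (bigD1_seq w) ?msupp_uniq //= big1_seq => [|w' /andP[nw gw']].
    rewrite big1_seq => [|u' /andP[nu fu']].
      rewrite !addr0 mcoeffZ mcoeffX eqxx mulr1.
      by rewrite mulf_neq0 // -mcoeff_msupp.
    apply: big1_seq => w' /= gw'.
    rewrite mcoeffZ mcoeffX; case: eqP => [E|_]; last by rewrite mulr0.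
    have := lt_uw _ _ fu' gw'.
    by rewrite E revlex_lt_irr xpair_eqE (negbTE nu) => /(_ isT).
  rewrite mcoeffZ mcoeffX; case: eqP => [E|_]; last by rewrite mulr0.
  have := lt_uw _ _ fu gw'.
  by rewrite E revlex_lt_irr xpair_eqE (negbTE nw) andbF => /(_ isT).
move=> t /msuppM_le/allpairsP[[u' w'] /= [fu' gw' ->]] ne.
by apply: lt_uw => //; apply: contraNneq ne => -[-> ->].
Qed.

Lemma initial_prod (I : Type) (r : seq I) (Q : pred I) (F : I -> P K n)
    (u : I -> mon n) :
  (forall i, Q i -> is_initial_mon prec (F i) (u i)) ->
  is_initial_mon prec (\prod_(i <- r | Q i) F i) (\sum_(i <- r | Q i) u i)%MM.
Proof.
move=> Fu; elim/big_rec2: _ => [|i p t Qi IH].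
  by rewrite -mpolyX0; apply: initialX.
by apply: initialM => //; apply: Fu.
Qed.

End RevLex.

(** * Generic matrices *)

Section GenericMatrices.
Context (K : fieldType).

Definition lead_sub (R : nzRingType) n (A : 'M[R]_n) (j : 'I_n) : 'M_j.+1 :=
  mxsub (widen_ord (ltn_ord j)) (widen_ord (ltn_ord j)) A.

Definition lower_unitriangular n (L : 'M[K]_n) : Prop :=
  (forall j, L j j = 1) /\ (forall r j : 'I_n, (r < j)%N -> L r j = 0).

(** LU decomposition: column j of C is supported on the indices up to j, where it
  solves the leading square system with the last basis vector on the right. *)
Lemma lu_exists n (A : 'M[K]_n) : (forall j, \det (lead_sub A j) != 0) ->
  exists2 C : 'M[K]_n, (forall l j : 'I_n, (j < l)%N -> C l j = 0) &
    lower_unitriangular (A *m C).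
Proof.
move=> minor.
pose c j := invmx (lead_sub A j) *m delta_mx ord_max (0 : 'I_1).
exists (\matrix_(l, j) if (l < j.+1)%N then c j (inord l) 0 else 0) => [l j|].
  by rewrite mxE ltnS ltnNge => /negbTE ->.
have AC (r j : 'I_n) : (r < j.+1)%N ->
    (A *m \matrix_(l, j) if (l < j.+1)%N then c j (inord l) 0 else 0) r j
      = (r == j)%:R.
  move=> rj; rewrite !mxE.
  under eq_bigr do rewrite mxE mulrC.
  rewrite (eq_bigr (fun l : 'I_n =>
     if (l < j.+1)%N then c j (inord l) 0 * A r l else 0)) => [|l _]; last first.
    by case: ifP; rewrite // mul0r.
  rewrite -big_mkcond (big_ord_narrow (ltn_ord j)) /=.
  have /matrixP/(_ (Ordinal rj) 0) :
      lead_sub A j *m c j = delta_mx ord_max (0 : 'I_1).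
    by rewrite mulKVmx // unitmxE unitfE.
  rewrite !mxE andbT => E; transitivity ((Ordinal rj == ord_max)%:R : K) => //.
  rewrite -E; apply: eq_bigr => l _; rewrite inord_val mulrC; congr (_ * _).
  by rewrite [RHS]mxE; congr (fun_of_matrix A); apply: val_inj.
split=> [j|r j rj]; first by rewrite AC ?eqxx.
by rewrite AC 1?ltnW //; case: eqP rj => // ->; rewrite ltnn.
Qed.

Definition generic_mx n (A : 'M[K]_n.+1) : Prop :=
  [/\ A \in unitmx, (forall j, \det (lead_sub A j) != 0)
    & (forall a, invmx A a ord_max != 0)].

(** The adjugate replaces the inverse, which is not polynomial: the two differ
  by the determinant. *)
Definition generic_poly n : {mpoly K[n.+1 * n.+1]} :=
  let X : 'M[{mpoly K[n.+1 * n.+1]}]_n.+1 :=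
    \matrix_(i, j) 'X_(mxvec_index i j) in
  (\prod_j \det (lead_sub X j)) * \prod_a (\adj X) a ord_max.

Lemma generic_polyE n (A : 'M[K]_n.+1) :
  (generic_poly n).@[fun k => mxvec A 0 k]
  = (\prod_j \det (lead_sub A j)) * \prod_a (\adj A) a ord_max.
Proof.
pose ev := @meval (n.+1 * n.+1) K (fun k => mxvec A 0 k).
pose X : 'M[{mpoly K[n.+1 * n.+1]}]_n.+1 := \matrix_(i, j) 'X_(mxvec_index i j).
have XA : map_mx ev X = A.
  by apply/matrixP=> i j; rewrite !mxE /ev /= mevalXU mxvecE.
rewrite /generic_poly -/X mevalM !(rmorph_prod (meval _)); congr (_ * _).
  apply: eq_bigr => j _; rewrite -[in RHS]XA -det_map_mx; congr (\det _).
  by apply/matrixP=> r l; rewrite !mxE.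
by apply: eq_bigr => a _; rewrite -[in RHS]XA -map_mx_adj [RHS]mxE.
Qed.

Lemma generic_mxP n (A : 'M[K]_n.+1) :
  generic_mx A <->
  A \in unitmx /\ (generic_poly n).@[fun k => mxvec A 0 k] != 0.
Proof.
rewrite generic_polyE mulf_eq0 negb_or; split.
  move=> [Au minor last]; split=> //; apply/andP; split.
    by apply/prodf_neq0 => j _; apply: minor.
  apply/prodf_neq0 => a _; have := last a.
  by rewrite /invmx Au mxE mulf_eq0 negb_or => /andP[].
move=> [Au /andP[/prodf_neq0 minor /prodf_neq0 last]]; split=> // [j|a].
  exact: minor.
by rewrite /invmx Au mxE mulf_neq0 ?last // invr_eq0 -unitfE -unitmxE.
Qed.

Lemma generic_mx_open n : zariski_open_GL [set A | @generic_mx n A]%classic.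
Proof.
exists [set generic_poly n]%classic; rewrite predeqE => A /=; split.
  by move=> /generic_mxP[Au Ag]; split=> //; exists (generic_poly n).
by move=> [Au [f -> Ag]]; apply/generic_mxP.
Qed.

Lemma generic_mx_neq0 n : ([set A | @generic_mx n A] !=set0)%classic.
Proof.
(* The inverse of 1 - N is 1 + N; its last column consists of ones, and all
   leading blocks of 1 - N are unitriangular. *)
pose N : 'M[K]_n.+1 := \matrix_(a, b) ((b == ord_max) && (a != ord_max))%:R.
have NN : N *m N = 0.
  apply/matrixP=> a b; rewrite !mxE big1 // => c _; rewrite !mxE.
  by case: (c == ord_max); rewrite ?andbF ?mulr0 ?mul0r.
have AB : (1%:M - N) *m (1%:M + N) = 1%:M.
  by rewrite mulmxBl !mulmxDr !mul1mx mulmx1 NN addr0 addrK.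
have [Au Bu] := mulmx1_unit AB.
exists (1%:M - N); split=> // [j|a].
  rewrite -det_tr det_trig.
    apply/prodf_neq0 => i _; rewrite !mxE eqxx.
    by rewrite andbN subr0 oner_eq0.
  apply/is_trig_mxP=> r l rl; rewrite !mxE -!val_eqE /=.
  rewrite gtn_eqF // [r == _ :> nat]ltn_eqF ?subrr //.
  by rewrite (leq_trans rl) // -ltnS (leq_trans (ltn_ord l)).
have -> : invmx (1%:M - N) = 1%:M + N.
  by apply: (can_inj (mulKmx Au)); rewrite mulmxV ?AB.
rewrite !mxE eqxx /=.
by case: (a == _); rewrite /= ?addr0 ?add0r ?mulr1n oner_eq0.
Qed.

End GenericMatrices.

(** * Linear substitutions *)

Section Substitution.
Context (K : fieldType) (d e : nat) (n : 'I_d -> nat) (n' : 'I_e -> nat).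
Context (h : var n -> P K n').

HB.instance Definition _ := GRing.RMorphism.copy (psubst h)
  (comp_mpoly [tuple h (enum_val r) | r < #|var n|]).
HB.instance Definition _ := GRing.Linear.copy (psubst h)
  (comp_mpoly [tuple h (enum_val r) | r < #|var n|]).

Lemma psubstX (u : mon n) : psubst h 'X_[u] = \prod_v h v ^+ expo u v.
Proof.
rewrite /psubst comp_mpolyX (reindex enum_rank) /=; last first.
  exact/onW_bij/enum_rank_bij.
by apply: eq_bigr => v _; rewrite tnth_mktuple enum_rankK.
Qed.

Lemma psubstE p :
  psubst h p = \sum_(u <- msupp p) p@_u *: \prod_v h v ^+ expo u v.
Proof.
by rewrite /psubst comp_mpolyEX; apply: eq_bigr => u _; rewrite -psubstX.
Qed.

Lemma psubstZ c p : psubst h (c *: p) = c *: psubst h p.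
Proof. exact: comp_mpolyZ. Qed.

Lemma psubst_pvar v : psubst h (pvar K v) = h v.
Proof.
rewrite /pvar /psubst /comp_mpoly mmapX mmap1U tnth_mktuple.
by rewrite enum_rankK.
Qed.

End Substitution.

Section GLAction.
Context (K : fieldType) (d : nat) (n : 'I_d -> nat).

Lemma mpolyX_pvar (u : mon n) :
  'X_[u] = \prod_v pvar K v ^+ expo u v :> P K n.
Proof.
rewrite mpolyXE_id (reindex enum_rank) //=; apply/onW_bij/enum_rank_bij.
Qed.

Lemma psubst_id (p : P K n) : psubst (pvar K (n := n)) p = p.
Proof.
rewrite psubstE [RHS]mpolyE.
by apply: eq_bigr => u _; rewrite -mpolyX_pvar.
Qed.

Lemma psubst_comp d1 d2 (n1 : 'I_d1 -> nat) (n2 : 'I_d2 -> nat)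
    (h : var n -> P K n1) (g : var n1 -> P K n2) p :
  psubst g (psubst h p) = psubst (fun v => psubst g (h v)) p.
Proof.
rewrite [psubst h p]psubstE [RHS]psubstE (linear_sum (psubst g)) /=.
apply: eq_bigr => u _.
rewrite psubstZ (rmorph_prod (psubst g)); congr (_ *: _).
by apply: eq_bigr => v _; rewrite (rmorphXn (psubst g)).
Qed.

Lemma eq_psubst d1 (n1 : 'I_d1 -> nat) (h g : var n -> P K n1) p :
  h =1 g -> psubst h p = psubst g p.
Proof.
move=> hg; rewrite !psubstE; apply: eq_bigr => u _.
by under eq_bigr do rewrite hg.
Qed.

Implicit Types A B : forall i : 'I_d, 'M[K]_(n i).

HB.instance Definition _ A := GRing.RMorphism.copy (GL_act A)
  (psubst (fun v : var n =>
    \sum_(k < n (tag v)) A (tag v) k (tagged v) *: pvar K (mkvar k))).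
HB.instance Definition _ A := GRing.Linear.copy (GL_act A)
  (psubst (fun v : var n =>
    \sum_(k < n (tag v)) A (tag v) k (tagged v) *: pvar K (mkvar k))).

Lemma GL_act_mkvar A i (j : 'I_(n i)) :
  GL_act A (pvar K (mkvar j)) = \sum_k A i k j *: pvar K (mkvar k).
Proof. by rewrite /GL_act psubst_pvar. Qed.

Lemma GL_act_comp A B p :
  GL_act A (GL_act B p) = GL_act (fun i => A i *m B i) p.
Proof.
rewrite [X in GL_act A X]/GL_act [LHS]psubst_comp; apply: eq_psubst => v.
rewrite (linear_sum (psubst _)) /=.
under eq_bigr do rewrite psubstZ psubst_pvar /= scaler_sumr.
rewrite exchange_big /=; apply: eq_bigr => k _; rewrite mxE scaler_suml.
by apply: eq_bigr => l _; rewrite scalerA mulrC.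
Qed.

Lemma GL_act1 (p : P K n) : GL_act (fun i => 1%:M) p = p.
Proof.
rewrite -[RHS]psubst_id; apply: eq_psubst => v.
rewrite (bigD1 (tagged v)) //= mxE eqxx scale1r mkvarK big1 ?addr0 // => k kv.
by rewrite mxE (negbTE kv) scale0r.
Qed.

Context (prec : rel (var n)) (prec_order : var_order prec).

(** The image of x_(i,j) is x_(i,j) plus a combination of the x_(i,r) with r >
  j, all of which are smaller. *)
Lemma initial_lower A i (j : 'I_(n i)) : lower_unitriangular (A i) ->
  is_initial_mon prec (GL_act A (pvar K (mkvar j))) (mvar (mkvar j)).
Proof.
case: prec_order => irr tr tot pcol [Ajj A0].
rewrite GL_act_mkvar.
have mk_inj (k l : 'I_(n i)) : (mvar (mkvar k) == mvar (mkvar l)) = (k == l).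
  by rewrite eq_mnm1 (inj_eq enum_rank_inj) -tag_eqE /tag_eq /= eqxx tagged_asE.
have coef (l : 'I_(n i)) :
    (\sum_k A i k j *: pvar K (mkvar k))@_(mvar (mkvar l)) = A i l j.
  rewrite raddf_sum (bigD1 l) //= big1 ?addr0 => [|k kl].
    by rewrite mcoeffZ mcoeffX eqxx mulr1.
  by rewrite mcoeffZ mcoeffX mk_inj (negbTE kl) mulr0.
split=> [|w]; first by rewrite mcoeff_msupp coef Ajj oner_eq0.
have [[l ->]|wl] := pselect (exists l : 'I_(n i), w = mvar (mkvar l)); last first.
  rewrite mcoeff_msupp raddf_sum big1 /= ?eqxx // => k _.
  rewrite mcoeffZ mcoeffX; case: eqP => [E|_]; last by rewrite mulr0.
  by case: wl; exists k.
rewrite mcoeff_msupp coef mk_inj => Alj lj.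
have jl : (j < l)%N.
  rewrite ltn_neqAle eq_sym lj leqNgt; apply: contra_neqN Alj => lj'.
  exact: A0.
rewrite /revlex_lt !mdeg1 ltnn eqxx /=; apply/existsP; exists (mkvar l).
have neq_jl : (mkvar j == mkvar l) = false.
  by apply/eqP=> /(congr1 (@mvar d n))/eqP; rewrite mk_inj eq_sym (negbTE lj).
rewrite !expo_mvar eqxx neq_jl /=; apply/forallP=> y; apply/implyP=> yl.
rewrite !expo_mvar; have -> : (mkvar l == y) = false.
  by apply: contraTF yl => /eqP <-; rewrite irr.
suff -> : (mkvar j == y) = false by [].
apply/eqP=> E; move: yl; rewrite -E => /(tr _ _ _ (pcol _ _ _ jl)).
by rewrite irr.
Qed.

End GLAction.

(** * The Stanley-Reisner ideal of the balanced squeezed complex *)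

Section Ideals.
Context (R : comNzRingType).

Lemma ideal_gen_ideal (S : set R) : is_ideal (ideal_gen S).
Proof.
split=> [I [[]]//|f g fI gI I /[dup] IS [[_ addI _] _]
  |a f fI I /[dup] IS [[_ _ mulI] _]].
  by apply: addI; [apply: fI | apply: gI].
by apply: mulI; apply: fI.
Qed.

Lemma ideal_sum (I : set R) (T : Type) (r : seq T) (Q : pred T) (F : T -> R) :
  is_ideal I -> (forall t, Q t -> I (F t)) -> I (\sum_(t <- r | Q t) F t).
Proof. by move=> [I0 addI _] IF; apply: big_ind. Qed.

Lemma ideal_preim (R' : comNzRingType) (f : {rmorphism R -> R'}) (I : set R') :
  is_ideal I -> is_ideal (f @^-1` I)%classic.
Proof.
move=> [I0 addI mulI]; split; rewrite /preimage /=; first by rewrite rmorph0.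
  by move=> a b Ia Ib; rewrite rmorphD; apply: addI.
by move=> a b Ib; rewrite rmorphM; apply: mulI.
Qed.

End Ideals.

Definition last_var (d : nat) (m : 'I_d -> nat) (i : 'I_d) : var (succv m) :=
  @mkvar d (succv m) i ord_max.

Section Facets.
Context (d : nat) (m : 'I_d -> nat).
Local Notation n := (succv m).
Implicit Types (u w : mon m).

Lemma expo_csf u (v w : var m) : color_squarefree u ->
  (0 < expo u v)%N -> (0 < expo u w)%N -> tag v = tag w -> v = w.
Proof.
move=> [_ inj]; case: v w => i j [i' k] /= + + E.
by case: i' / E k => k; move=> uj uk; rewrite (inj i j k).
Qed.

(** For u color-squarefree, the position of the only vertex of color i in
  F_d(u); [ord_max] is the added vertex (m_i + 1)^(i). *)
Definition vertex u (i : 'I_d) : 'I_(n i) :=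
  if [pick j : 'I_(m i) | (0 < expo u (mkvar j))%N] is Some j
  then widen_ord (leqnSn (m i)) j else ord_max.

Lemma vertexE u i (j : 'I_(m i)) : color_squarefree u ->
  (vertex u i == widen_ord (leqnSn (m i)) j) = (0 < expo u (mkvar j))%N.
Proof.
move=> ucsf; rewrite /vertex; case: pickP => [k uk|u0]; last first.
  by rewrite u0 -val_eqE /= gtn_eqF.
apply/eqP/idP=> [/(congr1 val)/= kj|uj].
  by have <- : k = j by apply: val_inj.
by congr widen_ord; case: ucsf => _; apply.
Qed.

Lemma vertex_max u i :
  (vertex u i == ord_max) = [forall j : 'I_(m i), expo u (mkvar j) == 0%N].
Proof.
rewrite /vertex; case: pickP => [k uk|u0].
  rewrite -val_eqE /= ltn_eqF //; apply/esym/forallP=> /(_ k).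
  by rewrite eqn0Ngt uk.
by rewrite eqxx; apply/esym/forallP=> j; rewrite eqn0Ngt u0.
Qed.

(** F_d(u) is a transversal of the colors. This is what makes it the choice of
  one point per color. *)
Lemma bal_facetE u (v : var n) : color_squarefree u ->
  (v \in bal_facet u) = (tagged v == vertex u (tag v)).
Proof.
move=> ucsf; case: v => i j /=; rewrite inE; apply/orP/eqP.
  case=> /imsetP[x]; rewrite inE => ux.
    case: x ux => i' k uk E; have Ei : i = i' := congr1 tag E.
    case: i' / Ei k uk E => k uk E; have -> := eq_from_Tagged E.
    by apply/esym/eqP; rewrite vertexE.
  move=> E; have Ei : i = x := congr1 tag E.
  case: x / Ei ux E => ux E; have -> := eq_from_Tagged E.
  by apply/esym/eqP; rewrite vertex_max.
have [jm|jm] := ltnP j (m i).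
  have -> : j = widen_ord (leqnSn (m i)) (Ordinal jm) by apply: val_inj.
  move=> /esym/eqP; rewrite vertexE // => uj; left; apply/imsetP.
  by exists (mkvar (Ordinal jm)); rewrite ?inE.
have -> : j = ord_max by apply/val_inj/anti_leq; rewrite jm -ltnS ltn_ord.
move=> /esym/eqP; rewrite vertex_max => u0; right; apply/imsetP.
by exists i; rewrite ?inE.
Qed.

End Facets.

Section Generators.
Context (K : fieldType) (d : nat) (m : 'I_d -> nat).
Context (U : set (mon m)) (U_ideal : csf_order_ideal U).
Local Notation n := (succv m).
Local Notation I := (stanley_reisner K (bal_complex U)).

Lemma nonface_mem (G : {set var n}) :
  (forall u, U u -> exists2 v, v \in G & tagged v != vertex u (tag v)) ->
  I (\prod_(v in G) pvar K v).
Proof.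
move=> nonface; apply: sub_gen_smallest; exists G => //.
move=> -[H [u Uu <-] /fintype.subsetP GH].
have [v vG] := nonface u Uu; case: U_ideal => /(_ u Uu) ucsf _ _ _.
by rewrite -(bal_facetE v ucsf) (GH v vG).
Qed.

Lemma pair_mem i (j k : 'I_(n i)) : j != k ->
  I (pvar K (mkvar j) * pvar K (mkvar k)).
Proof.
move=> jk; have vjk : mkvar j != mkvar k.
  by apply: contraNneq jk => E; rewrite (eq_from_Tagged E).
have -> : pvar K (mkvar j) * pvar K (mkvar k) =
    \prod_(v in [set mkvar j; mkvar k]) pvar K v.
  rewrite big_setU1 ?big_set1 //= inE //.
apply: nonface_mem => u Uu.
have [ju|ju] := eqVneq j (vertex u i); last first.
  by exists (mkvar j); rewrite ?inE ?eqxx.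
exists (mkvar k); rewrite ?inE ?eqxx ?orbT //=.
by rewrite -ju eq_sym.
Qed.


Context (U_shifted : csf_shifted U).

(** The variables are replaced one at a time; the parameter w collects those
  already treated. *)
Lemma shift_seq (s : seq (var m)) (g : var m -> var m) (w : mon m) :
  {in s, forall v, tag (g v) = tag v /\ (tagged (g v) <= tagged v)%N} ->
  U (\sum_(v <- s) mvar (g v) + w)%MM -> U (\sum_(v <- s) mvar v + w)%MM.
Proof.
elim: s w => [|v s IH] w gle; first by rewrite !big_nil.
rewrite !big_cons -!addmA => Ugv.
have gle_s : {in s, forall x, tag (g x) = tag x /\ (tagged (g x) <= tagged x)%N}.
  by move=> x xs; apply: gle; rewrite inE xs orbT.
have addmCA (a b c : mon m) : (a + (b + c) = b + (a + c))%MM.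
  by rewrite !addmA [X in (X + _)%MM]addmC.
have {}Ugv : U (mvar v + (\sum_(x <- s) mvar (g x) + w))%MM.
  have [] := gle v (mem_head _ _); move: Ugv {gle}; move: (g v) => gv.
  case: gv v => i j [i' k] /= + E; case: i' / E k => k Uj jk.
  exact: U_shifted jk Uj.
by rewrite addmCA; apply: IH; rewrite // addmCA.
Qed.

Lemma csf_sum (u : mon m) : color_squarefree u ->
  u = (\sum_(v | (0 < expo u v)%N) mvar v)%MM.
Proof.
move=> [sqf _]; apply: monP => x; rewrite expo_sum.
have [ux|] := posnP (expo u x).
  rewrite ux big1 // => v uv; rewrite expo_mvar.
  by case: eqP uv => // ->; rewrite ux.
move=> ux; rewrite (bigD1 x) //= expo_mvar eqxx big1 => [|v /andP[_ vx]].
  by apply/eqP; rewrite addn0 eqn_leq sqf.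
by rewrite expo_mvar (negbTE vx).
Qed.

(** If the vertices f v were contained in F_d(w) with w in U, they would all be
  of the form [incl_var (g v)], their indices being at most those of the v. Then
  the product of the g v would divide w, hence lie in U, and shifting each g v
  up to v would give u in U. *)
Lemma choice_mem (u : mon m) (f : var m -> var n) :
  color_squarefree u -> ~ U u ->
  (forall v, (0 < expo u v)%N ->
     tag (f v) = tag v /\ (tagged (f v) <= tagged v)%N) ->
  I (\prod_(v | (0 < expo u v)%N) pvar K (f v)).
Proof.
case: U_ideal => csf down U0 _ ucsf nUu f_le.
have f_inj : {in [set v | (0 < expo u v)%N] &, injective f}.
  move=> v w; rewrite !inE => uv uw E; apply: (expo_csf ucsf) => //.
  by rewrite -(f_le v uv).1 -(f_le w uw).1 E.
have -> : \prod_(v | (0 < expo u v)%N) pvar K (f v) =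
    \prod_(x in f @: [set v | (0 < expo u v)%N]) pvar K x.
  by rewrite (big_imset _ f_inj); apply: eq_bigl => v; rewrite inE.
apply: nonface_mem => w Uw; apply: contrapT => face.
have /choice[g gP] : forall v, exists v' : var m, (0 < expo u v)%N ->
    [/\ tag v' = tag v, (tagged v' <= tagged v)%N & (0 < expo w v')%N].
  move=> v; have [_|uv] := posnP (expo u v); first by exists v.
  have [tfv lefv] := f_le v uv.
  have lt : (tagged (f v) < m (tag (f v)))%N.
    by apply: leq_ltn_trans lefv _; rewrite [in X in (_ < X)%N]tfv.
  exists (mkvar (Ordinal lt)) => _; split=> //.
  rewrite -(vertexE _ (csf w Uw)); apply: contrapT => /negP ne; apply: face.
  exists (f v); first by apply/imsetP; exists v; rewrite ?inE.
  apply: contraNneq ne => <-; apply/eqP/val_inj => //.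
apply: nUu; rewrite (csf_sum ucsf) -[X in U X]addm0 -big_filter.
apply: (shift_seq (g := g)) => [v|]; first by rewrite mem_filter => /andP[/gP[]].
rewrite addm0 big_filter; apply: down Uw _; apply/lemonP => x.
rewrite expo_sum; under eq_bigr do rewrite expo_mvar.
have [[v [uv <-]]|nox] := pselect (exists v, (0 < expo u v)%N /\ g v = x).
  have [tv _ wv] := gP v uv.
  rewrite (bigD1 v) //= eqxx big1 ?addn0 // => v' /andP[uv' v'v].
  case: eqP => // E; case/eqP: v'v; apply: (expo_csf ucsf) => //.
  by have [tv' _ _] := gP v' uv'; rewrite -tv' E.
rewrite big1 // => v uv; case: eqP => // E.
by case: nox; exists v.
Qed.

Implicit Types A C : forall i : 'I_d, 'M[K]_(n i).

Lemma triangular_mem C (u : mon m) :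
  (forall i (l j : 'I_(n i)), (j < l)%N -> C i l j = 0) ->
  color_squarefree u -> ~ U u ->
  I (\prod_(v | (0 < expo u v)%N) GL_act C (pvar K (incl_var v))).
Proof.
move=> Cup ucsf nUu.
(* The coefficient of x_v in column v of C, set to 0 at the variables of another
   color, so that all factors become sums over one index type and the product
   can be expanded. *)
pose c (v : var m) (x : var n) : K :=
  \sum_(k < n (tag v)) (C (tag v) k (tagged (incl_var v)) *+ (mkvar k == x)).
have cE v : GL_act C (pvar K (incl_var v)) = \sum_x c v x *: pvar K x.
  rewrite GL_act_mkvar; under [RHS]eq_bigr do rewrite scaler_suml.
  rewrite exchange_big /=; apply: eq_bigr => k _.
  rewrite (bigD1 (mkvar k)) //= eqxx mulr1n big1 ?addr0 // => x.
  by rewrite eq_sym => /negbTE ->; rewrite mulr0n scale0r.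
have c_le v x : c v x != 0 -> tag x = tag v /\ (tagged x <= tagged v)%N.
  move=> cvx; suff [k [<- Ck]] : exists k : 'I_(n (tag v)),
      mkvar k = x /\ C (tag v) k (tagged (incl_var v)) != 0.
    by split=> //=; rewrite leqNgt; apply: contra_neqN Ck => lt_vk; apply: Cup.
  apply: contrapT => no; move: cvx; rewrite /c big1 ?eqxx // => k _.
  case: eqP => E; last by rewrite mulr0n.
  rewrite mulr1n; apply/eqP; apply: contrapT => /negP Ck.
  by apply: no; exists k.
have I_ideal : is_ideal I by apply: ideal_gen_ideal.
have [v0 _] : exists v : var m, (0 < expo u v)%N.
  apply: contrapT => no; apply: nUu; case: U_ideal => _ _ U0 _.
  suff -> : u = 0%MM by [].
  apply: monP => v; rewrite /expo mnm0E; apply/eqP; rewrite -leqn0 leqNgt.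
  by apply/negP => uv; apply: no; exists v.
under eq_bigr do rewrite cE.
rewrite (big_distr_big_dep (incl_var v0)); apply: (ideal_sum _ I_ideal) => f _.
have [/forallP cf|] := boolP [forall v, (0 < expo u v)%N ==> (c v (f v) != 0)].
  rewrite scaler_prod; case: I_ideal => _ _ mulI.
  rewrite -mul_mpolyC; apply: mulI; apply: choice_mem => // v uv.
  by apply: c_le; apply: (implyP (cf v)).
rewrite negb_forall => /existsP[v]; rewrite negb_imply negbK => /andP[uv /eqP cv].
by rewrite (bigD1 v) //= cv scale0r mul0r; case: I_ideal.
Qed.

(** The terms in x_a x_b with a <> b are nonfaces; the hypothesis says that the
  coefficients of the squares vanish. *)
Lemma quadric_mem (B : forall i : 'I_d, 'M[K]_(n i)) (i : 'I_d)
    (c : 'I_(n i) -> K) (j k : 'I_(n i)) :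
  (forall a,
     B i a j * B i a k = \sum_(l < n i) c l * (B i a l * B i a ord_max)) ->
  I (GL_act B (pvar K (mkvar j) * pvar K (mkvar k)
       - \sum_(l < n i) c l *: (pvar K (mkvar l) * pvar K (last_var m i)))).
Proof.
move=> diag.
pose x (a : 'I_(n i)) := pvar K (mkvar a).
have prodE p q : GL_act B (x p * x q) =
    \sum_a \sum_b (B i a p * B i b q) *: (x a * x b).
  rewrite /x (rmorphM (GL_act B)) /= !GL_act_mkvar big_distrlr /=.
  apply: eq_bigr => a _; apply: eq_bigr => b _.
  by rewrite -scalerAl -scalerAr scalerA.
have -> : GL_act B (x j * x k - \sum_(l < n i) c l *: (x l * x ord_max)) =
    \sum_a \sum_b
      (B i a j * B i b k - \sum_(l < n i) c l * (B i a l * B i b ord_max)) *: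
      (x a * x b).
  rewrite (raddfB (GL_act B)) /= prodE (linear_sum (GL_act B)) /=.
  under [X in _ - X]eq_bigr => l _.
    rewrite [GL_act B _]psubstZ -/(GL_act B _) prodE scaler_sumr.
    under eq_bigr do rewrite scaler_sumr.
    over.
  rewrite [X in _ - X]exchange_big /= -sumrB; apply: eq_bigr => a _.
  rewrite [X in _ - X]exchange_big /= -sumrB; apply: eq_bigr => b _.
  rewrite scalerBl scaler_suml; congr (_ - _).
  by apply: eq_bigr => l _; rewrite scalerA.
have I_ideal : is_ideal I by apply: ideal_gen_ideal.
apply: (ideal_sum _ I_ideal) => a _; apply: (ideal_sum _ I_ideal) => b _.
have [<-|ab] := eqVneq a b.
  by rewrite diag subrr scale0r; case: I_ideal.
rewrite -mul_mpolyC; case: I_ideal => _ _; apply; exact: pair_mem.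
Qed.

Context (prec : rel (var n)) (prec_order : var_order prec).

(** A quadratic multiple of the smallest variable of color i is smaller than a
  quadratic monomial in the other variables of color i, wherever the remaining colors
  stand in the order. *)
Lemma initial_quadric (i : 'I_d) (c : 'I_(n i) -> K) (j k : 'I_(n i)) :
  j != ord_max -> k != ord_max ->
  is_initial_mon prec (pvar K (mkvar j) * pvar K (mkvar k)
       - \sum_(l < n i) c l *: (pvar K (mkvar l) * pvar K (last_var m i)))
    (mvar (mkvar j) + mvar (mkvar k))%MM.
Proof.
move=> jmax kmax; case: prec_order => irr tr _ pcol.
have mk_neq (a b : 'I_(n i)) : a != b -> (mkvar a == mkvar b) = false.
  by move=> ab; apply/eqP => E; case/eqP: ab; apply: eq_from_Tagged E.
set f := _ - _.
have coef t : f@_t = (mvar (mkvar j) + mvar (mkvar k) == t)%MM%:R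
    - \sum_(l < n i) c l * (mvar (mkvar l) + mvar (last_var m i) == t)%MM%:R.
  rewrite mcoeffB -mpolyXD mcoeffX raddf_sum /=; congr (_ - _).
  by apply: eq_bigr => l _; rewrite mcoeffZ -mpolyXD mcoeffX.
have lt_quad (l : 'I_(n i)) : revlex_lt prec
    (mvar (mkvar l) + mvar (last_var m i))%MM
    (mvar (mkvar j) + mvar (mkvar k))%MM.
  rewrite /revlex_lt !mdegD !mdeg1 ltnn eqxx /=; apply/existsP.
  exists (last_var m i).
  rewrite !expoD !expo_mvar eqxx addn1 (mk_neq j) // (mk_neq k) //=.
  apply/forallP=> y; apply/implyP=> ymax.
  have neq (a : 'I_(n i)) : (mkvar a == y) = false.
    apply/eqP=> E; move: ymax; rewrite -E.
    have [->|amax] := eqVneq a ord_max; first by rewrite irr.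
    have alt : (a < (ord_max : 'I_(n i)))%N.
      by rewrite ltn_neqAle amax -ltnS ltn_ord.
    by move=> /(tr _ _ _ (pcol _ _ _ alt)); rewrite irr.
  by rewrite !expoD !expo_mvar !neq.
split=> [|w].
  rewrite mcoeff_msupp coef eqxx big1 ?subr0 ?oner_eq0 // => l _.
  case: eqP => [E|_]; last by rewrite mulr0.
  by have := lt_quad l; rewrite E revlex_lt_irr.
rewrite mcoeff_msupp coef => + wn.
move: wn; rewrite eq_sym => /negbTE ->; rewrite sub0r oppr_eq0.
have [[l <-] //|no] := pselect (exists l : 'I_(n i),
  (mvar (mkvar l) + mvar (last_var m i))%MM = w).
rewrite big1 ?eqxx // => l _; case: eqP => [E|_]; last by rewrite mulr0.
by case: no; exists l.
Qed.

End Generators.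

(** * Multidegrees and the evaluation functionals *)

Section Restriction.
Context (d : nat) (m : 'I_d -> nat).
Local Notation n := (succv m).
Implicit Types (u : mon m) (w : mon n).

(** The standard monomials are the w with [U (low_part w)]: the added variables
  x_(i,m_i+1) may occur with any exponent. *)
Definition low_part w : mon m :=
  [multinom expo w (incl_var (enum_val r)) | r < #|var m|].

Definition lift_mon u : mon n := (\sum_v mvar (incl_var v) *+ expo u v)%MM.

Lemma expo_low_part w v : expo (low_part w) v = expo w (incl_var v).
Proof. by rewrite /expo /low_part mnmE enum_rankK. Qed.

Lemma incl_var_inj : injective (@incl_var d m).
Proof.
move=> [i j] [i' k] E; have Ei : i = i' := congr1 tag E.
case: i' / Ei k E => k E.
have /= jk := congr1 (@nat_of_ord _) (eq_from_Tagged E).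
by congr existT; apply: val_inj.
Qed.

Lemma var_succP (x : var n) :
  (exists v, x = incl_var v) \/ (exists i : 'I_d, x = last_var m i).
Proof.
case: x => i j; have [jm|jm] := ltnP j (m i).
  left; exists (mkvar (Ordinal jm)); rewrite /incl_var /mkvar /=.
  by congr existT; apply: val_inj.
right; exists i; rewrite /mkvar; congr existT.
by apply/val_inj/anti_leq; rewrite jm -ltnS ltn_ord.
Qed.

Lemma incl_var_neq_max (v : var m) i :
  (incl_var v == last_var m i) = false.
Proof.
apply/eqP; case: v => i' j E; have Ei : i' = i := congr1 tag E.
case: i / Ei E => E.
have /= jm := congr1 (@nat_of_ord _) (eq_from_Tagged E).
by have := ltn_ord j; rewrite jm ltnn.
Qed.

Lemma expo_sum_incl (c : var m -> nat) (x : var n) :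
  expo (\sum_v mvar (incl_var v) *+ c v)%MM x =
  (\sum_v c v * (incl_var v == x))%N.
Proof.
rewrite expo_sum; apply: eq_bigr => v _.
by rewrite -expo_mvar mulnC; apply: mulmnE.
Qed.

Lemma expo_lift u v : expo (lift_mon u) (incl_var v) = expo u v.
Proof.
rewrite expo_sum_incl (bigD1 v) //= eqxx muln1 big1 ?addn0 // => v' /negbTE v'v.
by rewrite (inj_eq incl_var_inj) v'v muln0.
Qed.

Lemma expo_lift_max u i : expo (lift_mon u) (last_var m i) = 0%N.
Proof.
by rewrite expo_sum_incl big1 // => v _; rewrite incl_var_neq_max muln0.
Qed.

Lemma lift_mon_le u w : (lift_mon u <= w)%MM <-> (u <= low_part w)%MM.
Proof.
split=> /lemonP uw; apply/lemonP => x.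
  by rewrite expo_low_part -expo_lift.
have [[v ->]|[i ->]] := var_succP x; last by rewrite expo_lift_max.
by rewrite expo_lift -expo_low_part.
Qed.

Lemma inclX (K : fieldType) u : incl 'X_[u] = 'X_[lift_mon u] :> P K n.
Proof. by rewrite /incl psubstX /lift_mon -mprodXnE.
Qed.

Lemma lift_mvar v : lift_mon (mvar v) = mvar (incl_var v).
Proof.
apply: monP => x; have [[v' ->]|[i ->]] := var_succP x.
  by rewrite expo_lift !expo_mvar (inj_eq incl_var_inj).
by rewrite expo_lift_max expo_mvar incl_var_neq_max.
Qed.

Lemma lift_monD u u' : lift_mon (u + u')%MM = (lift_mon u + lift_mon u')%MM.
Proof.
apply: monP => x; rewrite expoD; have [[v ->]|[i ->]] := var_succP x.
  by rewrite !expo_lift expoD.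
by rewrite !expo_lift_max.
Qed.

Lemma lift_mon_sum (Q : pred (var m)) (F : var m -> mon m) :
  lift_mon (\sum_(v | Q v) F v)%MM = (\sum_(v | Q v) lift_mon (F v))%MM.
Proof.
have lift_mon0 : lift_mon 0%MM = 0%MM;
  last exact: (big_morph lift_mon lift_monD lift_mon0).
apply: monP => x; have [[v ->]|[i ->]] := var_succP x;
  rewrite ?expo_lift ?expo_lift_max;
  by rewrite /expo !mnm0E.
Qed.

(** In a color that occurs, the vertex tells which variable x_(i,j), j <= m_i,
  divides w, if any, and the degree then gives the exponent of x_(i,m_i+1). In a
  color that does not occur all exponents are 0. *)
Lemma mcdeg_vertex_inj w w' :
  color_squarefree (low_part w) -> color_squarefree (low_part w') ->
  mcdeg w = mcdeg w' ->
  (forall i, mcdeg w i != 0%N ->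
     vertex (low_part w) i = vertex (low_part w') i) ->
  w = w'.
Proof.
move=> csf csf' ww' vww'.
have expo01 z i (j : 'I_(m i)) : color_squarefree (low_part z) ->
    expo z (incl_var (mkvar j)) =
    (vertex (low_part z) i == widen_ord (leqnSn (m i)) j).
  move=> zcsf; rewrite (vertexE j zcsf) -expo_low_part.
  by case: zcsf => /(_ (mkvar j)); case: (expo _ _) => [|[]].
have eq_low i (j : 'I_(m i)) : mcdeg w i != 0%N ->
    expo w (incl_var (mkvar j)) = expo w' (incl_var (mkvar j)).
  by move=> /vww' E; rewrite !expo01 // E.
apply: monP => x; have [wx|wx] := eqVneq (mcdeg w (tag x)) 0%N.
  have := expo_le_mcdeg w x; have := expo_le_mcdeg w' x.
  by rewrite -ww' wx !leqn0 => /eqP -> /eqP ->.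
have [[v E]|[i E]] := var_succP x; rewrite E in wx *.
  by rewrite -(mkvarK v); apply: eq_low.
have := congr1 (fun a : 'X_{1..d} => a i) ww'.
rewrite !mcdegE /succv !big_ord_recr /= => /eqP.
set s := (\sum_(j < _) _)%N; set s' := (\sum_(j < _) _)%N.
have <- : s = s' by apply: eq_bigr => j _; apply: (eq_low i j).
by rewrite eqn_add2l => /eqP.
Qed.

End Restriction.

Section Evaluation.
Context (K : fieldType) (d : nat) (n : 'I_d -> nat).
Context (A : forall i : 'I_d, 'M[K]_(n i)) (c : forall i : 'I_d, 'I_(n i)).

Definition point_coord (v : var n) : K :=
  invmx (A (tag v)) (c (tag v)) (tagged v).

(** Restriction of polynomials to the span of the points p_(i,c_i), where t_i is
  the parameter of color i. It is a ring homomorphism, and its coefficients are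
  the evaluation functionals in each multidegree. *)
Definition eval_lines (p : P K n) : {mpoly K[d]} :=
  mmap (@mpolyC d K)
    (fun r => point_coord (enum_val r) *: 'X_(tag (enum_val r))) p.

HB.instance Definition _ := GRing.RMorphism.copy eval_lines
  (mmap (@mpolyC d K)
    (fun r => point_coord (enum_val r) *: 'X_(tag (enum_val r)))).

Lemma eval_linesZ a p : eval_lines (a *: p) = a *: eval_lines p.
Proof. by rewrite /eval_lines mmapZ mul_mpolyC. Qed.

Definition point_mon (t : mon n) : K := \prod_v point_coord v ^+ expo t v.

Lemma eval_linesX (t : mon n) :
  eval_lines 'X_[t] = point_mon t *: 'X_[mcdeg t].
Proof.
rewrite /eval_lines mmapX /mmap1 (reindex enum_rank) /=; last first.
  exact/onW_bij/enum_rank_bij.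
under eq_bigr do rewrite enum_rankK exprZn.
rewrite scaler_prod; congr (_ *: _).
rewrite big_var mpolyXE_id; apply: eq_bigr => i _.
by rewrite mcdegE -prodrXr.
Qed.

Lemma eval_lines_pvar v :
  eval_lines (pvar K v) = point_coord v *: 'X_(tag v).
Proof. by rewrite /eval_lines /pvar mmapX mmap1U enum_rankK. Qed.

(** The linear form y_(i,j) takes the value 1 at p_(i,j) and 0 at the other
  points of color i, because these are the rows of the inverse matrix. *)
Lemma eval_lines_GL v : (forall i, A i \in unitmx) ->
  eval_lines (GL_act A (pvar K v)) = (c (tag v) == tagged v)%:R *: 'X_(tag v).
Proof.
move=> Au; case: v => i j; rewrite GL_act_mkvar (rmorph_sum eval_lines) /=.
under eq_bigr do rewrite eval_linesZ eval_lines_pvar scalerA /=.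
rewrite -scaler_suml; congr (_ *: _).
have /matrixP/(_ (c i) j) := mulVmx (Au i); rewrite !mxE => <-.
by apply: eq_bigr => k _; rewrite mulrC.
Qed.

(** The monomials of multidegree a are enumerated inside the bounded ones,
  because the dimension count needs a finite index type. *)
Lemma eval_lines_coef (a : 'X_{1..d}) (p : P K n) :
  (eval_lines p)@_a =
  \sum_(t : {t : 'X_{1..#|var n| < (mdeg a).+1} | mcdeg (bmnm t) == a})
     p@_(bmnm (val t)) * point_mon (bmnm (val t)).
Proof.
pose T := {t : 'X_{1..#|var n| < (mdeg a).+1} | mcdeg (bmnm t) == a}.
pose L := [seq bmnm (val t) | t : T].
transitivity (\sum_(t <- L) p@_t * point_mon t); last by rewrite big_image.
have Luniq : uniq L.
  by rewrite map_inj_uniq ?enum_uniq // => s t /val_inj/val_inj.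
have memL t : (t \in L) = (mcdeg t == a).
  apply/fintype.imageP/idP => [[s _ ->]|ta]; first exact: (valP s).
  have tb : (mdeg t < (mdeg a).+1)%N by rewrite -(eqP ta) mdeg_mcdeg.
  by exists (exist _ (BMultinom tb) ta).
transitivity (\sum_(t <- msupp p | mcdeg t == a) p@_t * point_mon t).
  rewrite {1}(mpolyE p) (rmorph_sum eval_lines) raddf_sum [RHS]big_mkcond /=.
  apply: eq_bigr => t _; rewrite eval_linesZ eval_linesX !mcoeffZ mcoeffX.
  by case: ifP; rewrite ?mulr1 // !mulr0.
rewrite [RHS](bigID (fun t => p@_t != 0)) /= [X in _ + X]big1 ?addr0; last first.
  by move=> t; rewrite negbK => /eqP ->; rewrite mul0r.
rewrite -big_filter -[RHS]big_filter; apply: perm_big.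
apply: uniq_perm; rewrite ?filter_uniq ?msupp_uniq // => t.
by rewrite !mem_filter memL mcoeff_msupp andbC.
Qed.

End Evaluation.

(** * The generic initial ideal *)

Section GenericInitialIdeal.
Context (K : fieldType) (d : nat) (m : 'I_d -> nat).
Context (U : set (mon m)) (U_ideal : csf_order_ideal U).
Context (U_shifted : csf_shifted U).
Local Notation n := (succv m).
Local Notation I := (stanley_reisner K (bal_complex U)).
Context (prec : rel (var n)) (prec_order : var_order prec).
Context (A : forall i : 'I_d, 'M[K]_(n i)) (A_gen : forall i, generic_mx (A i)).

Lemma A_unit i : A i \in unitmx. Proof. by case: (A_gen i). Qed.

Lemma non_csf_divisor (u : mon m) : ~ color_squarefree u ->
  exists i, exists j k : 'I_(m i), (mvar (mkvar j) + mvar (mkvar k) <= u)%MM.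
Proof.
move=> ncsf; apply: contrapT => no; apply: ncsf; split=> [v|i j k uj uk].
  rewrite leqNgt; apply/negP => uv; apply: no.
  exists (tag v), (tagged v), (tagged v); apply/lemonP => x.
  by rewrite mkvarK expoD !expo_mvar addnn; case: eqP => // <-.
apply: contrapT => jk; apply: no; exists i, j, k; apply/lemonP => x.
rewrite expoD !expo_mvar; case: eqP => [<-|_].
  by case: eqP => // E; case: jk; rewrite (eq_from_Tagged E).
by case: eqP => // <-.
Qed.

(** The linear factors y_(i,1), ..., y_(i,j) combine to a form with initial
  monomial x_(i,j): this is the column of L in A C = L. *)
Lemma initial_csf (u : mon m) : color_squarefree u -> ~ U u ->
  exists2 f, I f & is_initial_mon prec (GL_act A f) (lift_mon u).
Proof.
move=> ucsf nUu.
have lu i : {C : 'M[K]_(n i) | (forall l j : 'I_(n i), (j < l)%N -> C l j = 0) /\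
    lower_unitriangular (A i *m C)}.
  by apply: cid; case: (A_gen i) => _ /lu_exists[C]; exists C.
pose C i := sval (lu i).
exists (\prod_(v | (0 < expo u v)%N) GL_act C (pvar K (incl_var v))).
  apply: triangular_mem => // i; exact: (svalP (lu i)).1.
rewrite (rmorph_prod (GL_act A)) [in lift_mon u](csf_sum ucsf) lift_mon_sum.
apply: initial_prod => // v _.
rewrite lift_mvar /= GL_act_comp; apply: initial_lower => //.
exact: (svalP (lu _)).2.
Qed.

(** The quadric x_j x_k - sum_l c_l x_l x_max has to vanish at every point of
  color i. This is a linear system with matrix A^-1 for c once the equation at
  each point is divided by the last coordinate of the point. *)
Lemma initial_pair i (j k : 'I_(m i)) : exists2 f, I f &
  is_initial_mon prec (GL_act A f)
    (lift_mon (mvar (mkvar j) + mvar (mkvar k))%MM).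
Proof.
pose j' := widen_ord (leqnSn (m i)) j; pose k' := widen_ord (leqnSn (m i)) k.
pose B i := invmx (A i).
have [_ _ Bmax] := A_gen i.
pose y : 'cV[K]_(n i) := \col_a (B i a j' * B i a k' / B i a ord_max).
pose c l := (A i *m y) l 0.
pose Q := pvar K (mkvar j') * pvar K (mkvar k')
  - \sum_(l < n i) c l *: (pvar K (mkvar l) * pvar K (last_var m i)).
exists (GL_act B Q).
  apply: quadric_mem => // a.
  have /matrixP/(_ a 0) : B i *m (A i *m y) = y by rewrite mulKmx ?A_unit.
  rewrite [RHS]mxE !mxE => E.
  under eq_bigr do rewrite mulrA [c _ * _]mulrC.
  by rewrite -mulr_suml E mulfVK.
rewrite GL_act_comp.
have -> : (fun i => A i *m B i) = (fun i => 1%:M).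
  by apply: functional_extensionality_dep => i'; rewrite mulmxV ?A_unit.
rewrite GL_act1 lift_monD !lift_mvar; apply: initial_quadric => //.
  by rewrite -val_eqE /= ltn_eqF.
by rewrite -val_eqE /= ltn_eqF.
Qed.

(** A divisor of u suffices, because initial monomials are multiplicative. *)
Lemma exists_initial_nonstandard (u : mon m) : ~ U u ->
  exists2 w, (w <= u)%MM &
    exists2 f, I f & is_initial_mon prec (GL_act A f) (lift_mon w).
Proof.
move=> nUu.
have [ucsf|/non_csf_divisor[i [j [k jku]]]] := pselect (color_squarefree u).
  by exists u; [exact: lepm_refl | exact: initial_csf].
exists (mvar (mkvar j) + mvar (mkvar k))%MM => //; exact: initial_pair.
Qed.

(** A nonface is not contained in F_d(u), so one of its vertices v is not the
  chosen one of its color, and y_v vanishes at the chosen point. *)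
Lemma eval_lines_stanley_reisner (u : mon m) f : U u -> I f ->
  eval_lines A (vertex u) (GL_act A f) = 0.
Proof.
move=> Uu If; apply: (If [set g | eval_lines A (vertex u) (GL_act A g) = 0]%classic).
split=> [|_ [G nface <-]] /=.
  split=> /= [|g h g0 h0|a g g0].
  - by rewrite (rmorph0 (GL_act A)) (rmorph0 (eval_lines A _)).
  - by rewrite (rmorphD (GL_act A)) (rmorphD (eval_lines A _)) /= g0 h0 addr0.
  - by rewrite (rmorphM (GL_act A)) (rmorphM (eval_lines A _)) /= g0 mulr0.
have [v vG vu] : exists2 v, v \in G & vertex u (tag v) != tagged v.
  apply: contrapT => no; apply: nface; exists (bal_facet u); first by exists u.
  apply/fintype.subsetP => v vG; case: U_ideal => /(_ u Uu) ucsf _ _ _.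
  rewrite bal_facetE // eq_sym; apply: contrapT => /negP vu.
  by apply: no; exists v.
rewrite (rmorph_prod (GL_act A)) (rmorph_prod (eval_lines A _)) (bigD1 v) //=.
by rewrite eval_lines_GL ?(negbTE vu) ?scale0r ?mul0r //; apply: A_unit.
Qed.

(** Multiplying by a monomial stays in the kernel of the evaluations, since
  these are ring homomorphisms. *)
Lemma initial_killed (w : mon n) : ~ U (low_part w) ->
  exists2 g, (forall u, U u -> eval_lines A (vertex u) g = 0) &
    is_initial_mon prec g w.
Proof.
move=> /exists_initial_nonstandard[u /lift_mon_le uw [f If fu]].
exists ('X_[w - lift_mon u] * GL_act A f).
  by move=> u' Uu'; rewrite rmorphM /= eval_lines_stanley_reisner // mulr0.
by rewrite -{2}(submK uw); apply: initialM => //; apply: initialX.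
Qed.

(** The product of the y_(i,c_i)^(a_i) separates the choices of points, up to
  the colors absent from a. *)
Lemma eval_lines_dual (a : 'X_{1..d}) (c c' : forall i : 'I_d, 'I_(n i)) :
  eval_lines A c' (GL_act A (\prod_i pvar K (mkvar (c i)) ^+ a i))
  = [forall i, (a i != 0%N) ==> (c i == c' i)]%:R *: 'X_[a].
Proof.
rewrite (rmorph_prod (GL_act A)) (rmorph_prod (eval_lines A _)) /=.
have powE i : eval_lines A c' (GL_act A (pvar K (mkvar (c i)) ^+ a i)) =
    ((a i != 0%N) ==> (c i == c' i))%:R *: 'X_i ^+ a i.
  rewrite (rmorphXn (GL_act A)) (rmorphXn (eval_lines A _)) /=.
  rewrite eval_lines_GL /=; last exact: A_unit.
  rewrite exprZn eq_sym; congr (_ *: _).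
  by case: (a i) => [|b] /=; [rewrite expr0 | case: eqP; rewrite ?expr1n ?expr0n].
under eq_bigr do rewrite powE.
rewrite scaler_prod -mpolyXE_id; congr (_ *: _).
case: forallP => [ok|nok]; first by rewrite big1 // => i _; rewrite ok.
have /existsP[i /negbTE ni] : [exists i, ~~ ((a i != 0%N) ==> (c i == c' i))].
  by rewrite -negb_forall; apply/forallP.
by rewrite (bigD1 i) //= ni mul0r.
Qed.

(** Otherwise the standard monomial w and all nonstandard monomials of its
  multidegree a would be initial monomials of polynomials killed by the
  evaluations. These are one more than the dimension of the common kernel in
  degree a, which is the number of nonstandard monomials. *)
Lemma initial_mon_nonstandard (w : mon n) f :
  I f -> is_initial_mon prec (GL_act A f) w -> ~ U (low_part w).
Proof.
move=> If fw Uw; case: (U_ideal) => csf _ _ _.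
pose a := mcdeg w.
pose T : finType := {t : 'X_{1..#|var n| < (mdeg a).+1} | mcdeg (bmnm t) == a}.
pose mn (t : T) : mon n := bmnm (val t).
have mn_inj : injective mn by move=> s t /val_inj/val_inj.
have mnT t : mcdeg (mn t) = a := eqP (valP t).
have wb : (mdeg w < (mdeg a).+1)%N by rewrite mdeg_mcdeg.
pose t0 : T := exist _ (BMultinom wb) (eqxx a).
pose S : {set T} := [set t | `[< U (low_part (mn t)) >]]%SET.
pose X : {set T} := t0 |: ~: S.
have /choice[g gP] : forall t : T, exists g : P K n, t \in X ->
    (forall u, U u -> eval_lines A (vertex u) g = 0) /\
    is_initial_mon prec g (mn t).
  move=> t; have [->|tt0] := eqVneq t t0.
    exists (GL_act A f) => _; split=> // u Uu.
    exact: eval_lines_stanley_reisner.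
  have [/asboolP Ut|/asboolPn nUt] := boolP `[< U (low_part (mn t)) >].
    exists 0; rewrite !inE (negbTE tt0) /=.
    by have -> : `[< U (low_part (mn t)) >] by apply/asboolP.
  by have [g g0 gt] := initial_killed nUt; exists g.
pose e (s t : T) := point_mon A (vertex (low_part (mn s))) (mn t).
pose D (s : T) : P K n :=
  \prod_i pvar K (mkvar (vertex (low_part (mn s)) i)) ^+ a i.
have memS t : t \in S -> U (low_part (mn t)) by rewrite inE => /asboolP.
have t0S : t0 \in S by rewrite inE; apply/asboolP.
have : (#|X| + #|S| <= #|T|)%N.
  apply: (@card_initial_le K T (fun s t => revlex_lt prec (mn s) (mn t)) X S
    (fun s t => (g s)@_(mn t)) e (fun s t => (GL_act A (D s))@_(mn t))).
  - by move=> t; apply: revlex_lt_irr.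
  - by move=> t s z; apply: revlex_lt_trans.
  - by move=> x /gP[_ []]; rewrite mcoeff_msupp.
  - move=> x t /gP[_ [_ lt]]; rewrite -mcoeff_msupp => /lt.
    by have [->|tx /(_ tx)] := eqVneq t x; [left | right].
  - move=> x s /gP[g0 _] /memS Us.
    by rewrite -eval_lines_coef g0 ?mcoeff0.
  - move=> s s' /memS Us /memS Us'; rewrite -eval_lines_coef eval_lines_dual.
    rewrite mcoeffZ mcoeffX eqxx mulr1.
    congr ((nat_of_bool _)%:R); apply/forallP/eqP => [E|-> i]; last first.
      by rewrite eqxx implybT.
    apply: mn_inj; apply: mcdeg_vertex_inj (csf _ Us) (csf _ Us') _ _.
      by rewrite (mnT s) (mnT s').
    by move=> i; rewrite (mnT s) => ai; apply/eqP/(implyP (E i)).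
rewrite cardsU1 inE t0S /= -addnA [(#|_| + _)%N]addnC cardsC.
by rewrite add1n ltnn.
Qed.

Lemma initial_ideal_generic :
  initial_ideal prec (GL_act A @` I)%classic = extend (ideal_of K U).
Proof.
have ext_ideal := ideal_gen_ideal (incl (m := m) @` ideal_of K U)%classic.
have in_ideal : is_ideal (initial_ideal prec (GL_act A @` I)%classic).
  exact: ideal_gen_ideal.
rewrite predeqE => p; split; apply: smallest_sub => //.
  move=> _ [w [_ [f If <-] /(initial_mon_nonstandard If) nUw] <-].
  have ew : (lift_mon (low_part w) <= w)%MM by apply/lift_mon_le/lepm_refl.
  rewrite -(submK ew) mpolyXD; case: ext_ideal => _ _; apply.
  apply: sub_gen_smallest; exists 'X_[low_part w]; last exact: inclX.
  by apply: sub_gen_smallest; exists (low_part w).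
move=> _ [q Uq <-].
apply: (Uq (incl (m := m) @^-1` initial_ideal prec (GL_act A @` I))%classic); split.
  exact: (ideal_preim (psubst (fun v => pvar K (incl_var v))) in_ideal).
move=> _ [u /exists_initial_nonstandard[w wu [f If fw]] <-].
rewrite /preimage /= inclX -(submK wu) lift_monD mpolyXD.
case: in_ideal => _ _; apply; apply: sub_gen_smallest; exists (lift_mon w) => //.
by exists (GL_act A f) => //; exists f.
Qed.

End GenericInitialIdeal.

Theorem theorem4p2 (K : fieldType) (K_infinite : infinite_set [set: K]%classic)
    (d : nat) (d_ge1 : (1 <= d)%N) (m : 'I_d -> nat)
    (U : set (mon m)) (U_ideal : csf_order_ideal U) (U_shifted : csf_shifted U)
    (prec : rel (var (succv m))) (prec_order : var_order prec) :
  extend (ideal_of K U) = gin prec (stanley_reisner K (bal_complex U)).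
Proof.
pose W i : set 'M[K]_(succv m i) := [set A | generic_mx A]%classic.
have Wopen i : zariski_open_GL (W i) /\ (W i !=set0)%classic.
  by split; [exact: generic_mx_open | exact: generic_mx_neq0].
have initE A : (forall i, W i (A i)) ->
    initial_ideal prec (GL_act A @` stanley_reisner K (bal_complex U))%classic
    = extend (ideal_of K U).
  by move=> AW; apply: initial_ideal_generic.
apply/esym/xget_unique; first by exists W.
move=> J [V Vopen VJ].
have meet i : {A : 'M[K]_(succv m i) | V i A /\ W i A}.
  apply: cid; have [Vi Vi0] := Vopen i; have [Wi Wi0] := Wopen i.
  by have [A VA WA] := zariski_openI_neq0 K_infinite Vi Wi Vi0 Wi0; exists A.
rewrite -(initE (fun i => sval (meet i))) => [|i]; last exact: (svalP (meet i)).2.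
by rewrite (VJ (fun i => sval (meet i))) // => i; exact: (svalP (meet i)).1.
Qed.
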